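(* A binary relation $\succsim$ on $l_\infty$ satisfies Weak order, Monotonicity, Continuity, ICRP, Convexity and IDIS if and only if there exists a grounded and weak$^\star$-lower semicontinuous function $c:\mathcal D\to[0,\infty]$ such that $$I(x)=\min_{p\in\mathcal D}\{\langle x,p\rangle+c(p)\}$$ is a constant equivalent representing $\succsim$, where $\mathcal D=\mathcal B\cup\{(1-\delta)(1,\delta,\delta^2,\dots):\delta\in[0,1)\}$.
   Context: $l_\infty$: real bounded sequences $x=(x_0,x_1,\dots)$ with sup norm; $\theta\in\mathbb R$ also a constant sequence; $x\ge y$ coordinatewise. $ba(\mathbb N)$: norm dual of $l_\infty$ (bounded finitely additive signed measures on $2^{\mathbb N}$), pairing $\langle x,\mu\rangle$, weak$^\star$ topology. $\Delta$: finitely additive probability measures; sequences $(p_n)$ with $p_n\ge0,\sum p_n=1$ identified with countably additive measures; $\delta=0$ gives $(1,0,0,\dots)$. $\mathcal B$: Banach–Mazur limits, i.e. $\mu\in\Delta$ with $\langle x,\mu\rangle=\langle(x_1,x_2,\dots),\mu\rangle$ for all $x$. Grounded: infimum $0$. Constant equivalent: $I$ with $x\sim I(x)$, $x\succsim y\iff I(x)\ge I(y)$. Weak order: complete, transitive. Monotonicity: $x\ge y\Rightarrow x\succsim y$, $1\succ0$. Continuity: for $x\succsim y\succsim z$ the sets $\{\alpha\in[0,1]:\alpha x+(1-\alpha)z\succsim y\}$, $\{\alpha:y\succsim\alpha x+(1-\alpha)z\}$ are closed. ICRP: $x\succsim y\Rightarrow x+\theta\succsim y+\theta$. Convexity: $x\succsim\theta,y\succsim\theta\Rightarrow\lambda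 x+(1-\lambda)y\succsim\theta$ for $\lambda\in[0,1]$. IDIS: $x+d\succsim x\Rightarrow x+(0,d)\succsim x$, where $(0,d)=(0,d_0,d_1,\dots)$. *)

(* Defs.v *)
From Stdlib Require Import Reals List.
From Coquelicot Require Import Rbar.
Open Scope R_scope.

Definition seqR := nat -> R.
Definition bounded (x : seqR) : Prop := exists M, forall n, Rabs (x n) <= M.

Definition cst (t : R) : seqR := fun _ => t.
Definition sadd (x y : seqR) : seqR := fun n => x n + y n.
Definition sscal (a : R) (x : seqR) : seqR := fun n => a * x n.
Definition mix (l : R) (x y : seqR) : seqR := fun n => l * x n + (1 - l) * y n.
Definition sge (x y : seqR) : Prop := forall n, y n <= x n.
Definition shift (x : seqR) : seqR := fun n => x (S n).
Definition delay (d : seqR) : seqR := fun n => match n with O => 0 | S k => d k end.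

(* Elements of ba(N) = norm dual of l_infty, represented as functionals
   (evaluated on bounded sequences); <x, mu> = mu x. *)
Definition functional := seqR -> R.

(* Delta: finitely additive probability measures = positive, normalized,
   linear functionals on l_infty. *)
Definition in_Delta (mu : functional) : Prop :=
  (forall x y a b, bounded x -> bounded y ->
     mu (fun n => a * x n + b * y n) = a * mu x + b * mu y) /\
  (forall x, bounded x -> sge x (cst 0) -> 0 <= mu x) /\
  mu (cst 1) = 1.

Definition in_BM (mu : functional) : Prop :=
  in_Delta mu /\ forall x, bounded x -> mu x = mu (shift x).

Definition is_geom (mu : functional) (delta : R) : Prop :=
  forall x, bounded x ->
    infinite_sum (fun n => (1 - delta) * delta ^ n * x n) (mu x).

Definition in_D (mu : functional) : Prop :=
  in_BM mu \/ exists delta, 0 <= delta < 1 /\ is_geom mu delta.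

Section PrefConditions.
Variable pref : seqR -> seqR -> Prop.

Definition strict (x y : seqR) : Prop := pref x y /\ ~ pref y x.
Definition indiff (x y : seqR) : Prop := pref x y /\ pref y x.

Definition WeakOrder : Prop :=
  (forall x y, bounded x -> bounded y -> pref x y \/ pref y x) /\
  (forall x y z, bounded x -> bounded y -> bounded z ->
     pref x y -> pref y z -> pref x z).

Definition Monotonicity : Prop :=
  (forall x y, bounded x -> bounded y -> sge x y -> pref x y) /\
  strict (cst 1) (cst 0).

Definition Continuity : Prop :=
  forall x y z, bounded x -> bounded y -> bounded z ->
    pref x y -> pref y z ->
    closed_set (fun a => 0 <= a <= 1 /\ pref (mix a x z) y) /\
    closed_set (fun a => 0 <= a <= 1 /\ pref y (mix a x z)).

Definition ICRP : Prop :=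
  forall x y (t : R), bounded x -> bounded y ->
    pref x y -> pref (sadd x (cst t)) (sadd y (cst t)).

Definition Convexity : Prop :=
  forall x y (t l : R), bounded x -> bounded y -> 0 <= l <= 1 ->
    pref x (cst t) -> pref y (cst t) -> pref (mix l x y) (cst t).

Definition IDIS : Prop :=
  forall x d, bounded x -> bounded d ->
    pref (sadd x d) x -> pref (sadd x (delay d)) x.

Definition constant_equivalent (I : seqR -> R) : Prop :=
  (forall x, bounded x -> indiff x (cst (I x))) /\
  (forall x y, bounded x -> bounded y -> (pref x y <-> I y <= I x)).
End PrefConditions.

Definition grounded (c : functional -> Rbar) : Prop :=
  (forall p, in_D p -> Rbar_le (Finite 0) (c p)) /\
  (forall eps, 0 < eps -> exists p, in_D p /\ Rbar_lt (c p) (Finite eps)).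

(* weak* lower semicontinuity of c on D (relative weak* topology, basic
   neighbourhoods given by finitely many bounded sequences and eps) *)
Definition weakstar_lsc_on_D (c : functional -> Rbar) : Prop :=
  forall p, in_D p -> forall t : R, Rbar_lt (Finite t) (c p) ->
    exists (xs : list seqR) (eps : R), 0 < eps /\ Forall bounded xs /\
      forall q, in_D q ->
        (forall x, In x xs -> Rabs (q x - p x) < eps) ->
        Rbar_lt (Finite t) (c q).

Definition is_min_repr (c : functional -> Rbar) (I : seqR -> R) : Prop :=
  forall x, bounded x ->
    (exists p, in_D p /\ Finite (I x) = Rbar_plus (Finite (p x)) (c p)) /\
    (forall p, in_D p -> Rbar_le (Finite (I x)) (Rbar_plus (Finite (p x)) (c p))).

(* Main.v *)
(* The axioms make the certainty equivalent I a concave niveloid, so its directional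
   derivative g at x is superlinear with g >= inf, and IDIS says that the cone {g >= 0} is
   stable under the delay S. If g (a v - S v) > 0 and g v >= 0 for some a > 0 and v, then
   a - S is inverse positive; letting a decrease to the least such value yields a in [0, 1]
   with g (a d - S d) <= 0 for all d. By Hahn-Banach some probability p >= g satisfies
   p o S = a p, which forces p to be the geometric law of parameter a (a < 1) or a
   Banach-Mazur limit (a = 1). This p is a supergradient of I at x, so the minimum in the
   dual formula, with c (p) = sup_y (I y - p y), is attained on D. Conversely, each p in D
   satisfies p o S = a p with a in [0, 1], whence I (x + S d) is at least a mixture of
   I x and I (x + d). *)

From Stdlib Require Import Reals List Lra Lia Classical FunctionalExtensionality.
From Coquelicot Require Import Coquelicot.
From mathcomp Require boolp classical_sets.
Require Import Defs.

(** * Suprema of sets of reals *)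

(** [real] sends an infinite supremum to 0, so the value is meaningful only for nonempty sets
    bounded above. *)
Definition sup (E : R -> Prop) : R := real (Lub_Rbar E).

Lemma sup_lub (E : R -> Prop) (M a : R) :
  E a -> (forall r, E r -> r <= M) ->
  (forall r, E r -> r <= sup E) /\ (forall b, (forall r, E r -> r <= b) -> sup E <= b).
Proof.
intros Ea EM; unfold sup.
destruct (Lub_Rbar_correct E) as [ub least].
assert (le_M := least (Finite M) EM).
assert (ge_a := ub a Ea).
destruct (Lub_Rbar E) as [l| |]; simpl in *; try tauto.
split; [exact ub | intros b Hb; exact (least (Finite b) Hb)].
Qed.

Lemma sup_ub (E : R -> Prop) (M a : R) :
  (forall r, E r -> r <= M) -> E a -> a <= sup E.
Proof. intros EM Ea; exact (proj1 (sup_lub E M a Ea EM) a Ea). Qed.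

Lemma sup_le (E : R -> Prop) (M a : R) :
  E a -> (forall r, E r -> r <= M) -> sup E <= M.
Proof. intros Ea EM; exact (proj2 (sup_lub E M a Ea EM) M EM). Qed.

(** An element of either set bounds the other through [c], so both suprema are finite. *)
Lemma sup_plus_le (E F : R -> Prop) (c : R) :
  (exists a, E a) -> (exists b, F b) ->
  (forall a b, E a -> F b -> a + b <= c) -> sup E + sup F <= c.
Proof.
intros [a Ea] [b Fb] H.
assert (HE : forall b', F b' -> sup E <= c - b').
{ intros b' Fb'; apply (sup_le E _ a Ea); intros r Er.
  specialize (H r b' Er Fb'); lra. }
enough (sup F <= c - sup E) by lra.
apply (sup_le F _ b Fb); intros r Fr; specialize (HE r Fr); lra.
Qed.

Lemma sup_scal_le (E : R -> Prop) (a c : R) :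
  0 < a -> (exists r, E r) -> (forall r, E r -> a * r <= c) -> a * sup E <= c.
Proof.
intros ha [r Er] H.
enough (le : sup E <= c / a).
{ apply (Rmult_le_compat_l a) in le; [|lra].
  replace (a * (c / a)) with c in le by (field; lra); exact le. }
apply (sup_le E _ r Er); intros s Es.
apply (Rmult_le_reg_l a); [exact ha|].
replace (a * (c / a)) with c by (field; lra); exact (H s Es).
Qed.

(** * Bounded sequences *)

Lemma bounded_lin (a b : R) (x y : seqR) :
  bounded x -> bounded y -> bounded (fun n => a * x n + b * y n).
Proof.
intros [M HM] [N HN]; exists (Rabs a * M + Rabs b * N); intro n.
eapply Rle_trans; [apply Rabs_triang|]; rewrite !Rabs_mult.
apply Rplus_le_compat; apply Rmult_le_compat_l; auto using Rabs_pos.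
Qed.

Lemma bounded_cst (t : R) : bounded (cst t).
Proof. exists (Rabs t); intro n; apply Rle_refl. Qed.

Lemma bounded_sadd (x y : seqR) : bounded x -> bounded y -> bounded (sadd x y).
Proof.
intros bx by_; destruct (bounded_lin 1 1 x y bx by_) as [M HM].
exists M; intro n; specialize (HM n); rewrite !Rmult_1_l in HM; exact HM.
Qed.

Lemma bounded_sscal (a : R) (x : seqR) : bounded x -> bounded (sscal a x).
Proof.
intros bx; destruct (bounded_lin a 0 x x bx bx) as [M HM].
exists M; intro n; specialize (HM n); rewrite Rmult_0_l, Rplus_0_r in HM; exact HM.
Qed.

Lemma bounded_mix (l : R) (x y : seqR) : bounded x -> bounded y -> bounded (mix l x y).
Proof. apply bounded_lin. Qed.

Lemma bounded_shift (x : seqR) : bounded x -> bounded (shift x).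
Proof. intros [M HM]; exists M; intro n; apply HM. Qed.

Lemma bounded_delay (x : seqR) : bounded x -> bounded (delay x).
Proof.
intros [M HM]; exists M; intros [|n]; [|apply HM].
simpl; rewrite Rabs_R0; exact (Rle_trans _ _ _ (Rabs_pos _) (HM 0%nat)).
Qed.

#[local] Hint Resolve bounded_lin bounded_cst bounded_sadd bounded_sscal bounded_mix
  bounded_shift bounded_delay : bdd.

Lemma bounded_range (x : seqR) :
  bounded x -> exists M, 0 < M /\ forall n, - M <= x n <= M.
Proof.
intros [M HM]; exists (Rabs M + 1); split.
- pose proof (Rabs_pos M); lra.
- intro n; apply Rabs_le_between; specialize (HM n); pose proof (Rle_abs M); lra.
Qed.

Ltac seq_ext :=
  apply functional_extensionality; let n := fresh "n" in intro n;
  unfold mix, sadd, sscal, cst, delay, shift; destruct n; simpl; try field.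

(** * Superlinear functionals *)

(* Walley's coherent lower previsions, the lower envelopes of sets of finitely additive
   probabilities. *)
Definition coherent (g : functional) : Prop :=
  (forall x y, bounded x -> bounded y -> g x + g y <= g (sadd x y)) /\
  (forall a x, 0 <= a -> bounded x -> a * g x <= g (sscal a x)) /\
  (forall t x, bounded x -> sge x (cst t) -> t <= g x).

Section Coherent.
Context (g : functional) (cg : coherent g).

Lemma coherent_opp (x : seqR) : bounded x -> g x <= - g (sscal (-1) x).
Proof.
intro bx; destruct cg as [add [hom _]].
assert (h0 := add (cst 0) (cst 0) (bounded_cst 0) (bounded_cst 0)).
replace (sadd (cst 0) (cst 0)) with (cst 0) in h0 by seq_ext.
assert (h := add x (sscal (-1) x) bx (bounded_sscal _ _ bx)).
replace (sadd x (sscal (-1) x)) with (cst 0) in h by seq_ext.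
lra.
Qed.

(** Monotonicity and translation at once: [g x >= g y + g (x - y)], and [x - y >= t]. *)
Lemma coherent_ge (x y : seqR) (t : R) :
  bounded x -> bounded y -> (forall n, y n + t <= x n) -> g y + t <= g x.
Proof.
intros bx by_ H; destruct cg as [add [_ low]].
assert (bd : bounded (fun n => 1 * x n + -1 * y n)) by auto with bdd.
assert (h := add y _ by_ bd).
replace (sadd y _) with x in h by seq_ext.
assert (h' : t <= g (fun n => 1 * x n + -1 * y n)).
{ apply low; [exact bd|]; intro n; specialize (H n); unfold cst; lra. }
lra.
Qed.

Lemma coherent_le (x : seqR) (M : R) : bounded x -> (forall n, x n <= M) -> g x <= M.
Proof.
intros bx H; destruct cg as [_ [_ low]].
assert (h := coherent_opp x bx).
assert (- M <= g (sscal (-1) x)); [|lra].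
apply low; [auto with bdd|]; intro n; specialize (H n); unfold cst, sscal; lra.
Qed.

Lemma coherent_cst (t : R) : g (cst t) = t.
Proof.
apply Rle_antisym.
- apply coherent_le; [apply bounded_cst | intro n; apply Rle_refl].
- apply cg; [apply bounded_cst | intro n; apply Rle_refl].
Qed.

Lemma coherent_scal (a : R) (x : seqR) : 0 < a -> bounded x -> g (sscal a x) = a * g x.
Proof.
intros ha bx; destruct cg as [_ [hom _]]; apply Rle_antisym; [|apply hom; auto; lra].
assert (h := hom (/ a) (sscal a x) (Rlt_le _ _ (Rinv_0_lt_compat a ha)) (bounded_sscal _ _ bx)).
replace (sscal (/ a) (sscal a x)) with x in h by (seq_ext; lra).
apply (Rmult_le_compat_l a) in h; [|lra].
rewrite <- Rmult_assoc, Rinv_r, Rmult_1_l in h by lra; exact h.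
Qed.

(** The extension is [G x], the supremum of [g (x + z)] over [z] in [Z]. It is finite because
    [g (x + z) + g (- x) <= g z <= 0], and the choice of [z] at [- z] gives [G (- z) >= g 0 = 0]. *)
Lemma coherent_cone_extension (Z : seqR -> Prop) :
  (forall z, Z z -> bounded z) -> Z (cst 0) ->
  (forall z w, Z z -> Z w -> Z (sadd z w)) ->
  (forall a z, 0 <= a -> Z z -> Z (sscal a z)) ->
  (forall z, Z z -> g z <= 0) ->
  exists G, coherent G /\ (forall x, bounded x -> g x <= G x) /\
    forall z, Z z -> 0 <= G (sscal (-1) z).
Proof.
intros Zb Z0 Zadd Zscal Zle.
pose (E := fun x r => exists z, Z z /\ r = g (sadd x z)).
assert (EM : forall x, bounded x -> forall r, E x r -> r <= - g (sscal (-1) x)).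
{ intros x bx r [z [Zz ->]].
  assert (h := proj1 cg (sadd x z) (sscal (-1) x)
    (bounded_sadd _ _ bx (Zb z Zz)) (bounded_sscal _ _ bx)).
  replace (sadd (sadd x z) (sscal (-1) x)) with z in h by seq_ext.
  specialize (Zle z Zz); lra. }
assert (Ege : forall x, bounded x -> E x (g x)).
{ intros x bx; exists (cst 0); split; [exact Z0|]; f_equal; seq_ext. }
assert (up : forall x z, bounded x -> Z z -> g (sadd x z) <= sup (E x)).
{ intros x z bx Zz; apply (sup_ub _ _ _ (EM x bx)); exists z; auto. }
exists (fun x => sup (E x)); repeat split.
- intros x y bx by_; apply sup_plus_le; eauto.
  intros a b [z [Zz ->]] [w [Zw ->]].
  eapply Rle_trans; [apply (proj1 cg); auto with bdd|].
  replace (sadd (sadd x z) (sadd y w)) with (sadd (sadd x y) (sadd z w)) by seq_ext.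
  apply up; auto with bdd.
- intros a x [ha | <-] bx.
  + apply sup_scal_le; eauto; intros r [z [Zz ->]].
    rewrite <- coherent_scal by auto with bdd.
    replace (sscal a (sadd x z)) with (sadd (sscal a x) (sscal a z)) by seq_ext.
    apply up; auto with bdd; apply Zscal; auto; lra.
  + rewrite Rmult_0_l; eapply Rle_trans; [|apply (up (sscal 0 x) (cst 0)); auto with bdd].
    replace (sadd (sscal 0 x) (cst 0)) with (cst 0) by seq_ext.
    rewrite coherent_cst; lra.
- intros t x bx H; eapply Rle_trans; [|apply (up x (cst 0)); auto].
  replace (sadd x (cst 0)) with x by seq_ext; apply cg; auto.
- intros x bx; apply (sup_ub _ _ _ (EM x bx)); auto.
- intros z Zz; eapply Rle_trans; [|apply (up (sscal (-1) z) z); auto with bdd].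
  replace (sadd (sscal (-1) z) z) with (cst 0) by seq_ext.
  rewrite coherent_cst; lra.
Qed.

End Coherent.

(** * Zorn's lemma and Hahn-Banach domination *)

(** Pointwise suprema of chains stay superadditive: of two members, the larger one can serve at both
    arguments. *)
Lemma coherent_chain_sup (A : functional -> Prop) (h : functional) :
  A h -> (forall f, A f -> coherent f) ->
  (forall e f, A e -> A f -> (forall x, bounded x -> e x <= f x) \/
                             (forall x, bounded x -> f x <= e x)) ->
  exists G, coherent G /\ forall f, A f -> forall x, bounded x -> f x <= G x.
Proof.
intros Ah Acoh chain.
pose (E := fun x r => exists f, A f /\ r = f x).
assert (up : forall x f, bounded x -> A f -> f x <= sup (E x)).
{ intros x f bx Af; destruct (bounded_range x bx) as [M [_ HM]].
  apply (sup_ub _ M); [|exists f; auto].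
  intros r [e [Ae ->]]; apply coherent_le; auto; intro n; apply HM. }
assert (Eh : forall x, E x (h x)) by (intro x; exists h; auto).
exists (fun x => sup (E x)); repeat split.
- intros x y bx by_; apply sup_plus_le; eauto.
  intros a b [e [Ae ->]] [f [Af ->]].
  destruct (chain e f Ae Af) as [le | le].
  + specialize (le x bx); assert (hf := proj1 (Acoh f Af) x y bx by_).
    assert (hu := up _ f (bounded_sadd _ _ bx by_) Af); lra.
  + specialize (le y by_); assert (he := proj1 (Acoh e Ae) x y bx by_).
    assert (hu := up _ e (bounded_sadd _ _ bx by_) Ae); lra.
- intros a x [ha | <-] bx.
  + apply sup_scal_le; eauto; intros r [f [Af ->]].
    rewrite <- (coherent_scal f) by auto; apply up; auto with bdd.
  + rewrite Rmult_0_l; eapply Rle_trans; [|apply (up (sscal 0 x) h); auto with bdd].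
    replace (sscal 0 x) with (cst 0) by seq_ext.
    rewrite coherent_cst; auto; lra.
- intros t x bx H; eapply Rle_trans; [|apply (up x h); auto].
  apply (Acoh h Ah); auto.
- intros f Af x bx; apply up; auto.
Qed.

(** Zorn's lemma for a preorder: functionals are compared at bounded sequences only, so the order is
    not antisymmetric. *)
Lemma coherent_maximal (g : functional) : coherent g ->
  exists m, coherent m /\ (forall x, bounded x -> g x <= m x) /\
    forall f, coherent f -> (forall x, bounded x -> m x <= f x) ->
      forall x, bounded x -> f x <= m x.
Proof.
intro cg.
pose (T := {f : functional | coherent f /\ forall x, bounded x -> g x <= f x}).
pose (le := fun s t : T => forall x, bounded x -> proj1_sig s x <= proj1_sig t x).
assert (g_le : forall x, bounded x -> g x <= g x) by (intros; lra).
pose (t0 := exist _ g (conj cg g_le) : T).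
destruct (@classical_sets.ZL_preorder T t0 (fun s t => boolp.asbool (le s t)))
  as [m maxm].
- intro t; apply boolp.asboolT; intros x bx; lra.
- intros r s t rs st; apply boolp.asboolT; intros x bx.
  assert (h1 := boolp.asboolW rs x bx); assert (h2 := boolp.asboolW st x bx); lra.
- intros A Atot.
  destruct (classic (exists t, A t)) as [[t At] | nA].
  + destruct (coherent_chain_sup (fun f => exists s, A s /\ f = proj1_sig s) (proj1_sig t))
      as [G [cG HG]].
    * exists t; auto.
    * intros f [[s [cs gs]] [_ ->]]; exact cs.
    * intros e f [s [As ->]] [s' [As' ->]].
      destruct (Atot s s' As As') as [h | h]; [left | right]; exact (boolp.asboolW h).
    * assert (gG : forall x, bounded x -> g x <= G x).
      { intros x bx; eapply Rle_trans; [apply (proj2 (proj2_sig t) x bx)|].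
        apply HG; eauto. }
      exists (exist _ G (conj cG gG)); intros s As; apply boolp.asboolT.
      intros x bx; apply HG; eauto.
  (* The empty chain is bounded by [g] itself. *)
  + exists t0; intros s As; destruct nA; eauto.
- exists (proj1_sig m); split; [apply (proj2_sig m)|]; split; [apply (proj2_sig m)|].
  intros f cf mf.
  assert (gf : forall x, bounded x -> g x <= f x).
  { intros x bx; assert (h := proj2 (proj2_sig m) x bx); specialize (mf x bx); lra. }
  exact (boolp.asboolW (maxm (exist _ f (conj cf gf)) (boolp.asboolT mf))).
Qed.

(* A maximal coherent [m] is odd, hence additive: if m (-y) < - m y, then the cone extension
   along the ray of [y - m y] would increase m at [-y]. *)
Lemma coherent_dominated (g : functional) : coherent g ->
  exists p, in_Delta p /\ forall x, bounded x -> g x <= p x.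
Proof.
intro cg; destruct (coherent_maximal g cg) as [m [cm [gm maxm]]].
exists m; split; [|exact gm].
assert (opp : forall y, bounded y -> m (sscal (-1) y) = - m y).
{ intros y by_; apply Rle_antisym.
  { assert (h := coherent_opp m cm y by_); lra. }
  assert (bz : bounded (sadd y (cst (- m y)))) by auto with bdd.
  destruct (coherent_cone_extension m cm
    (fun z => exists a, 0 <= a /\ z = sscal a (sadd y (cst (- m y))))) as [G [cG [mG HG]]].
  - intros z [a [_ ->]]; auto with bdd.
  - exists 0; split; [lra | seq_ext].
  - intros z w [a [ha ->]] [b [hb ->]]; exists (a + b); split; [lra | seq_ext].
  - intros b z hb [a [ha ->]]; exists (b * a); split; [nra | seq_ext].
  - intros z [a [[ha | <-] ->]].
    + rewrite coherent_scal by auto.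
      enough (m (sadd y (cst (- m y))) <= 0) by nra.
      enough (m (sadd y (cst (- m y))) + m y <= m y) by lra.
      apply coherent_ge; auto; intro n; unfold sadd, cst; lra.
    + replace (sscal 0 _) with (cst 0) by seq_ext; rewrite coherent_cst; auto; lra.
  - eapply Rle_trans; [|apply (maxm G cG mG); auto with bdd].
    enough (0 + - m y <= G (sscal (-1) y)) by lra.
    eapply Rle_trans; [apply Rplus_le_compat_r, HG|].
    + exists 1; split; [lra | reflexivity].
    + apply coherent_ge; auto with bdd; intro n; unfold sscal, sadd, cst; lra. }
(* Oddness turns superadditivity at [- x], [- y] into subadditivity at [x], [y]. *)
assert (add : forall x y, bounded x -> bounded y -> m (sadd x y) = m x + m y).
{ intros x y bx by_; apply Rle_antisym; [|apply (proj1 cm); auto].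
  assert (h := proj1 cm (sscal (-1) x) (sscal (-1) y) (bounded_sscal _ _ bx)
    (bounded_sscal _ _ by_)).
  replace (sadd (sscal (-1) x) (sscal (-1) y)) with (sscal (-1) (sadd x y)) in h by seq_ext.
  rewrite !opp in h by auto with bdd; lra. }
assert (scal : forall a x, bounded x -> m (sscal a x) = a * m x).
{ intros a x bx; destruct (Rtotal_order a 0) as [ha | [-> | ha]].
  - replace (sscal a x) with (sscal (- a) (sscal (-1) x)) by seq_ext.
    rewrite coherent_scal, opp by (auto with bdd; lra); lra.
  - replace (sscal 0 x) with (cst 0) by seq_ext; rewrite coherent_cst; auto; lra.
  - apply coherent_scal; auto. }
repeat split.
- intros x y a b bx by_; change (fun n => a * x n + b * y n) with (sadd (sscal a x) (sscal b y)).
  rewrite add, !scal by auto with bdd; reflexivity.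
- intros x bx H; apply cm; auto.
- apply coherent_cst; exact cm.
Qed.

Lemma Delta_lin (p : functional) (x y z : seqR) (a b : R) :
  in_Delta p -> bounded x -> bounded y -> (forall n, z n = a * x n + b * y n) ->
  p z = a * p x + b * p y.
Proof.
intros dp bx by_ H; rewrite <- (proj1 dp) by auto.
f_equal; apply functional_extensionality; exact H.
Qed.

Lemma Delta_coherent (p : functional) : in_Delta p -> coherent p.
Proof.
intro dp; repeat split.
- intros x y bx by_; rewrite (Delta_lin p x y (sadd x y) 1 1); auto; [lra|].
  intro n; unfold sadd; ring.
- intros a x _ bx; rewrite (Delta_lin p x x (sscal a x) a 0); auto; [lra|].
  intro n; unfold sscal; ring.
- intros t x bx H; assert (bt := bounded_cst 1).
  assert (h : 0 <= p (fun n => 1 * x n + (- t) * cst 1 n)).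
  { apply dp; [auto with bdd|]; intro n; specialize (H n); unfold cst in *; lra. }
  rewrite (proj1 dp) in h by auto; rewrite (proj2 (proj2 dp)) in h; lra.
Qed.

(** * Eigenvalues of the delay operator *)

(** The operator [a - S], with [S] the delay. A linear [p] satisfies [p o S = a p] exactly when it
    vanishes on the range. *)
Definition delay_sub (a : R) (v : seqR) : seqR := fun n => a * v n - delay v n.

Lemma bounded_delay_sub (a : R) (v : seqR) : bounded v -> bounded (delay_sub a v).
Proof.
intro bv; replace (delay_sub a v) with (fun n => a * v n + -1 * delay v n); auto with bdd.
apply functional_extensionality; intro n; unfold delay_sub; ring.
Qed.

#[local] Hint Resolve bounded_delay_sub : bdd.

Section DelayEigenvalue.
Context (g : functional) (cg : coherent g).
Context (g_delay : forall d, bounded d -> 0 <= g d -> 0 <= g (delay d)).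

(** Split [a v = S v + (a - S) v], where [g (S v) >= 0]. *)
Lemma delay_sub_le (a : R) (v : seqR) :
  0 < a -> bounded v -> 0 <= g v -> g (delay_sub a v) <= a * g v.
Proof.
intros ha bv gv; rewrite <- coherent_scal by auto.
assert (h := proj1 cg (delay v) (delay_sub a v) (bounded_delay _ bv)
  (bounded_delay_sub _ _ bv)).
replace (sadd (delay v) (delay_sub a v)) with (sscal a v) in h.
- specialize (g_delay v bv gv); lra.
- apply functional_extensionality; intro n; unfold sadd, delay_sub, sscal; ring.
Qed.

(* By [delay_sub_le], [g] cannot take values in [0, k/a) along [w + s v] for s >= 0,
   where [k = g (delay_sub a w)]; so [g] stays nonnegative as s decreases to 0. *)
Lemma delay_sub_inverse_positive (a : R) (v w : seqR) :
  0 < a -> bounded v -> bounded w -> 0 <= g v ->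
  0 < g (delay_sub a v) -> 0 < g (delay_sub a w) -> 0 <= g w.
Proof.
intros ha bv bw gv hv hw.
destruct (bounded_range v bv) as [M [hM HM]].
pose (k := g (delay_sub a w) / a).
assert (hk : 0 < k) by (apply Rdiv_lt_0_compat; auto).
assert (hh : 0 < k / M) by (apply Rdiv_lt_0_compat; auto).
assert (gv' : 0 < g v).
{ assert (h := delay_sub_le a v ha bv gv); nra. }
pose (u := fun s => sadd w (sscal s v)).
assert (bu : forall s, bounded (u s)) by (intro; unfold u; auto with bdd).
assert (jump : forall s, 0 <= s -> 0 <= g (u s) -> k <= g (u s)).
{ intros s hs hu.
  assert (h := delay_sub_le a (u s) ha (bu s) hu).
  replace (delay_sub a (u s)) with (sadd (delay_sub a w) (sscal s (delay_sub a v))) in h.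
  - assert (h1 := proj1 cg (delay_sub a w) (sscal s (delay_sub a v))
      (bounded_delay_sub _ _ bw) (bounded_sscal _ _ (bounded_delay_sub _ _ bv))).
    assert (h2 := proj1 (proj2 cg) s (delay_sub a v) hs (bounded_delay_sub _ _ bv)).
    apply (Rmult_le_reg_l a); auto.
    replace (a * k) with (g (delay_sub a w)) by (unfold k; field; lra); nra.
  - unfold u, delay_sub; seq_ext. }
(* Decreasing [s] by at most [k / M] lowers [u s] by at most [k] in each coordinate, so a value of
   at least [k] stays nonnegative and [jump] applies again. *)
assert (descend : forall n s, 0 <= s <= INR n * (k / M) -> 0 <= g (u s) -> 0 <= g (u 0)).
{ induction n as [|n IH]; intros s hs hu.
  - simpl in hs; replace 0 with s by lra; replace s with 0 in hu by lra.
    replace s with 0 by lra; exact hu.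
  - rewrite S_INR in hs.
    apply (IH (Rmax 0 (s - k / M))).
    + split; [apply Rmax_l | apply Rmax_lub]; [|lra].
      apply Rmult_le_pos; [apply pos_INR | lra].
    + specialize (jump s (proj1 hs) hu).
      enough (g (u s) + - k <= g (u (Rmax 0 (s - k / M)))) by lra.
      apply coherent_ge; auto; intro n'; unfold u, sadd, sscal.
      assert (hd : 0 <= s - Rmax 0 (s - k / M) <= k / M).
      { unfold Rmax; destruct (Rle_dec 0 (s - k / M)); lra. }
      assert (hkM : k / M * M = k) by (field; lra).
      specialize (HM n'); nra. }
(* Chosen so that [g w + s0 * g v >= 0]: the descent starts from a nonnegative value. *)
pose (s0 := Rabs (g w) / g v).
assert (hs0 : 0 <= s0) by (apply Rdiv_le_0_compat; auto using Rabs_pos).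
destruct (INR_archimed (k / M) s0 hh) as [n hn].
replace w with (u 0) by (unfold u; seq_ext).
apply (descend n s0); [lra|].
assert (h1 := proj1 cg w (sscal s0 v) bw (bounded_sscal _ _ bv)).
assert (h2 := proj1 (proj2 cg) s0 v hs0 bv).
replace (s0 * g v) with (Rabs (g w)) in h2 by (unfold s0; field; lra).
assert (h3 := Rle_abs (- g w)); rewrite Rabs_Ropp in h3; unfold u; lra.
Qed.

(** The two sequences differ by [(b - a) v], which is at most [|b - a| M] in absolute value. *)
Lemma delay_sub_near (a b M : R) (v : seqR) :
  bounded v -> (forall n, - M <= v n <= M) ->
  g (delay_sub a v) - Rabs (b - a) * M <= g (delay_sub b v).
Proof.
intros bv HM.
enough (g (delay_sub a v) + - (Rabs (b - a) * M) <= g (delay_sub b v)) by lra.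
apply coherent_ge; auto with bdd; intro n; unfold delay_sub; specialize (HM n).
unfold Rabs; destruct (Rcase_abs (b - a)); nra.
Qed.

(* The eigenvalue is the infimum of the [a > 0] admitting [v] with [0 <= g v] and
   [0 < g (delay_sub a v)], as in the Collatz-Wielandt formula. *)
Lemma delay_eigenvalue : exists a, 0 <= a <= 1 /\
  forall d, bounded d -> g (delay_sub a d) <= 0.
Proof.
pose (E := fun a => 0 < a /\ exists v, bounded v /\ 0 <= g v /\ 0 < g (delay_sub a v)).
(* The constant 1 is a witness: [(a - S) 1] is [a] at index 0 and [a - 1] afterwards. *)
assert (E1 : forall a, 1 < a -> E a).
{ intros a ha; split; [lra|]; exists (cst 1).
  rewrite coherent_cst by auto; repeat split; auto with bdd; [lra|].
  apply (Rlt_le_trans _ (a - 1)); [lra|].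
  apply cg; auto with bdd.
  intros [|n]; unfold delay_sub, cst; simpl; lra. }
(* The infimum of [E] is obtained as the supremum of its lower bounds. *)
pose (L := fun l => forall e, E e -> l <= e).
assert (L0 : L 0) by (intros e [he _]; lra).
assert (L2 : forall l, L l -> l <= 2) by (intros l Ll; apply Ll, E1; lra).
destruct (sup_lub L 2 0 L0 L2) as [up least].
set (a := sup L) in *.
assert (a_le : forall e, E e -> a <= e).
{ intros e Ee; apply least; intros l Ll; apply Ll, Ee. }
assert (ha0 : 0 <= a) by (apply up, L0).
assert (ha1 : a <= 1).
{ apply Rnot_lt_le; intro h; enough (h' : a <= (1 + a) / 2) by lra.
  apply a_le, E1; lra. }
exists a; split; [auto|]; intros d bd; apply Rnot_lt_le; intro pos.
destruct (bounded_range d bd) as [M [hM HM]].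
set (eta := g (delay_sub a d)) in *.
assert (he : 0 < eta / M) by (apply Rdiv_lt_0_compat; auto).
assert (near : forall b, Rabs (b - a) < eta / M -> 0 < g (delay_sub b d)).
{ intros b hb; assert (h := delay_sub_near a b M d bd HM); fold eta in h.
  apply (Rmult_lt_compat_r M) in hb; auto.
  replace (eta / M * M) with eta in hb by (field; lra); lra. }
(* Some [e] in [E] lies within [eta / M] of the infimum [a]. Then [g ((e - S) d) > 0], and inverse
   positivity at [e] applies to [d]. *)
assert (gd : 0 <= g d).
{ destruct (classic (exists e, E e /\ e < a + eta / M)) as [[e [Ee he']] | none].
  - destruct (Ee) as [e0 [v [bv [gv hv]]]].
    apply (delay_sub_inverse_positive e v d); auto.
    apply near; specialize (a_le e Ee); rewrite Rabs_right; lra.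
  - exfalso; assert (h : L (a + eta / M)).
    { intros e Ee; apply Rnot_lt_le; intro h; apply none; eauto. }
    specialize (up _ h); lra. }
destruct (Rle_lt_or_eq_dec 0 a ha0) as [ha | ha].
(* This [b] is positive, below [a] and within [eta / M] of it, so [d] puts it in [E], against the
   choice of [a]. *)
- pose (b := Rmax (a / 2) (a - eta / M / 2)).
  assert (hb : 0 < b < a /\ a - b < eta / M).
  { unfold b, Rmax; destruct (Rle_dec (a / 2) (a - eta / M / 2)); lra. }
  assert (Eb : E b).
  { split; [lra|]; exists d; repeat split; auto.
    apply near; rewrite Rabs_left; lra. }
  specialize (a_le b Eb); lra.
(* For [a = 0] the operator is [- S]: then [g (- S d) > 0] and [g (S d) >= 0], against
   superadditivity. *)
- assert (h1 := g_delay d bd gd).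
  assert (h2 := coherent_opp g cg (delay d) (bounded_delay _ bd)).
  replace (sscal (-1) (delay d)) with (delay_sub a d) in h2; [fold eta in h2; lra|].
  rewrite <- ha; apply functional_extensionality; intro n; unfold delay_sub, sscal; ring.
Qed.

(** The range of [a - S] is a subspace on which [g <= 0]. Extending [g] along it and dominating the
    extension by [p] gives [p (S d) >= a * p d]; replacing [d] by [- d] gives equality. *)
Lemma delay_eigenvector : exists p a, in_Delta p /\ 0 <= a <= 1 /\
  (forall d, bounded d -> p (delay d) = a * p d) /\ forall x, bounded x -> g x <= p x.
Proof.
destruct delay_eigenvalue as [a [ha Ha]].
destruct (coherent_cone_extension g cg (fun z => exists d, bounded d /\ z = delay_sub a d))
  as [G [cG [gG HG]]].
- intros z [d [bd ->]]; auto with bdd.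
- exists (cst 0); split; [auto with bdd | unfold delay_sub; seq_ext].
- intros z w [d [bd ->]] [e [be ->]]; exists (sadd d e); split; [auto with bdd|].
  unfold delay_sub; seq_ext.
- intros b z _ [d [bd ->]]; exists (sscal b d); split; [auto with bdd|].
  unfold delay_sub; seq_ext.
- intros z [d [bd ->]]; auto.
- destruct (coherent_dominated G cG) as [p [dp Gp]].
  exists p, a; split; [auto|]; split; [auto|]; split.
  + assert (le : forall d, bounded d -> p (delay d) - a * p d >= 0).
    { intros d bd; assert (h := HG (delay_sub a d) (ex_intro _ d (conj bd eq_refl))).
      specialize (Gp (sscal (-1) (delay_sub a d)) ltac:(auto with bdd)).
      rewrite (Delta_lin p (delay d) d (sscal _ _) 1 (- a)) in Gp; auto with bdd; [lra|].
      intro n; unfold sscal, delay_sub; ring. }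
    intros d bd; assert (h1 := le d bd).
    assert (h2 := le (sscal (-1) d) (bounded_sscal _ _ bd)).
    rewrite (Delta_lin p d d (sscal (-1) d) (-1) 0) in h2; auto;
      [|intro n; unfold sscal; ring].
    rewrite (Delta_lin p (delay d) d (delay (sscal (-1) d)) (-1) 0) in h2; auto with bdd;
      [lra|].
    intros [|n]; unfold sscal; simpl; ring.
  + intros x bx; specialize (gG x bx); specialize (Gp x bx); lra.
Qed.

End DelayEigenvalue.

(** * Eigenfunctionals of the delay and membership in D *)

Section EigenvectorInD.
Context (p : functional) (a : R) (dp : in_Delta p).
Context (p_delay : forall d, bounded d -> p (delay d) = a * p d).

(** [1 - S 1] is the first unit sequence, so index 0 has mass [1 - a]; and [y] is [y 0] times that
    sequence plus [S (shift y)]. *)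
Lemma eigenvector_shift (y : seqR) :
  bounded y -> p y = (1 - a) * y 0%nat + a * p (shift y).
Proof.
intro by_.
assert (h0 : p (fun n => 1 * cst 1 n + -1 * delay (cst 1) n) = 1 - a).
{ rewrite (proj1 dp) by auto with bdd.
  rewrite p_delay, (proj2 (proj2 dp)) by auto with bdd; ring. }
rewrite (Delta_lin p (fun n => 1 * cst 1 n + -1 * delay (cst 1) n) (delay (shift y)) y
  (y 0%nat) 1); auto with bdd.
- rewrite h0, p_delay by auto with bdd; ring.
- intros [|n]; unfold cst, shift; simpl; ring.
Qed.

Lemma eigenvector_partial_sum (y : seqR) (n : nat) : bounded y ->
  p y = sum_f_R0 (fun k => (1 - a) * a ^ k * y k) n
        + a ^ S n * p (fun k => y (S n + k)%nat).
Proof.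
intro by_; induction n as [|n IH].
- rewrite eigenvector_shift by auto; simpl.
  change (fun k => y (S k)) with (shift y); ring.
- rewrite IH, (eigenvector_shift (fun k => y (S n + k)%nat)).
  + replace (shift (fun k => y (S n + k)%nat)) with (fun k => y (S (S n) + k)%nat).
    * rewrite Nat.add_0_r; simpl; ring.
    * apply functional_extensionality; intro k; unfold shift; f_equal; lia.
  + destruct by_ as [M HM]; exists M; intro k; apply HM.
Qed.

(** For [a = 1], [eigenvector_shift] is shift invariance. For [a < 1], the remainder after the
    partial sum is at most [a ^ (n + 1) M] and vanishes. As [0 ^ 0 = 1], [a = 0] gives the point
    mass at index 0. *)
Lemma eigenvector_in_D : 0 <= a <= 1 -> in_D p.
Proof.
intro ha; destruct (Req_dec a 1) as [a1 | a1].
{ left; split; [auto|]; intros x bx; rewrite eigenvector_shift, a1 by auto; ring. }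
right; exists a; split; [lra|]; intros x bx eps heps.
destruct (bounded_range x bx) as [M [hM HM]].
destruct (pow_lt_1_zero a) with (y := eps / M) as [N HN].
{ rewrite Rabs_right; lra. }
{ apply Rdiv_lt_0_compat; auto. }
exists N; intros n hn; unfold Rdist.
rewrite (eigenvector_partial_sum x n bx).
set (q := fun k => x (S n + k)%nat).
assert (bq : bounded q) by (destruct bx as [K HK]; exists K; intro k; apply HK).
assert (cp := Delta_coherent p dp).
assert (h1 : p q <= M) by (apply coherent_le; auto; intro k; apply HM).
assert (h2 : - M <= p q) by (apply cp; auto; intro k; apply HM).
replace (_ - _) with (- (a ^ S n * p q)) by ring.
rewrite Rabs_Ropp, Rabs_mult.
specialize (HN (S n) ltac:(lia)).
apply (Rmult_lt_compat_r M) in HN; auto.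
replace (eps / M * M) with eps in HN by (field; lra).
eapply Rle_lt_trans; [|exact HN].
apply Rmult_le_compat_l; [apply Rabs_pos | apply Rabs_le; lra].
Qed.

End EigenvectorInD.

(* [is_series_ext] at type [R], so that [ring] recognises the equations. *)
Lemma Rseries_ext (u v : nat -> R) (l : R) :
  (forall n, u n = v n) -> is_series u l -> is_series v l.
Proof. intro H; apply is_series_ext, H. Qed.

(** The converse: the shift undoes the delay, so Banach-Mazur limits have eigenvalue 1; reindexing
    the series gives a geometric law its own parameter as eigenvalue. *)
Lemma in_D_eigenvector (p : functional) : in_D p ->
  in_Delta p /\ exists a, 0 <= a <= 1 /\ forall d, bounded d -> p (delay d) = a * p d.
Proof.
intros [[dp inv] | [a [ha Hp]]].
- split; [auto|]; exists 1; split; [lra|]; intros d bd.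
  rewrite inv by auto with bdd; rewrite Rmult_1_l; reflexivity.
- assert (ser : forall x, bounded x ->
    is_series (fun n => (1 - a) * a ^ n * x n) (p x)).
  { intros x bx; apply is_series_Reals, Hp, bx. }
  assert (uniq : forall x l, bounded x ->
    is_series (fun n => (1 - a) * a ^ n * x n) l -> p x = l).
  { intros x l bx Hl; rewrite <- (is_series_unique _ _ (ser x bx)).
    apply is_series_unique, Hl. }
  split; [repeat split|].
  + intros x y b c bx by_; apply uniq; [auto with bdd|].
    apply (Rseries_ext (fun n => b * ((1 - a) * a ^ n * x n) + c * ((1 - a) * a ^ n * y n))).
    { intro n; ring. }
    apply @is_series_plus; apply @is_series_scal_l; auto.
  + intros x bx H.
    apply (is_lim_seq_le (fun _ => 0) (sum_n (fun n => (1 - a) * a ^ n * x n)) 0 (p x)).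
    * intro n; rewrite sum_n_Reals; apply cond_pos_sum; intro k.
      apply Rmult_le_pos; [apply Rmult_le_pos; [lra | apply pow_le; lra] | apply H].
    * apply is_lim_seq_const.
    * apply ser, bx.
  + apply uniq; [auto with bdd|].
    apply (Rseries_ext (fun n => (1 - a) * a ^ n)).
    { intro n; unfold cst; ring. }
    assert (h : is_series (fun n => a ^ n) (/ (1 - a))).
    { apply is_series_geom; rewrite Rabs_right; lra. }
    apply (is_series_scal_l (1 - a)) in h.
    change (is_series (fun n => (1 - a) * a ^ n) ((1 - a) * / (1 - a))) in h.
    rewrite Rinv_r in h by lra; exact h.
  + exists a; split; [lra|]; intros d bd; apply uniq; [auto with bdd|].
    (* The term of index 0 vanishes because [delay d] starts with 0. *)
    apply @is_series_decr_1.
    apply (Rseries_ext (fun n => a * ((1 - a) * a ^ n * d n))).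
    { intro n; simpl; ring. }
    replace (plus _ _) with (a * p d) by (unfold plus, opp; simpl; ring).
    apply @is_series_scal_l; auto.
Qed.

(** * Concave niveloids *)

(* The first clause packs monotonicity and translation invariance together. *)
Definition concave_niveloid (I : functional) : Prop :=
  (forall x y t, bounded x -> bounded y -> (forall n, y n + t <= x n) -> I y + t <= I x) /\
  (forall x y l, bounded x -> bounded y -> 0 <= l <= 1 ->
     l * I x + (1 - l) * I y <= I (mix l x y)).

(** IDIS at the base point [x], read through a representing functional. *)
Definition delay_averse_at (I : functional) (x : seqR) : Prop :=
  forall d, bounded d -> I x <= I (sadd x d) -> I x <= I (sadd x (delay d)).

(** The negative of the concave conjugate of [I]: the least [c] with [I <= p + c], possibly
    infinite. *)
Definition penalty (I p : functional) : Rbar :=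
  Lub_Rbar (fun r => exists y, bounded y /\ r = I y - p y).

Section Niveloid.
Context (I : functional) (nI : concave_niveloid I).

Lemma niveloid_translation (x : seqR) (t : R) : bounded x -> I (sadd x (cst t)) = I x + t.
Proof.
intro bx; apply Rle_antisym.
- enough (I (sadd x (cst t)) + - t <= I x) by lra.
  apply nI; auto with bdd; intro n; unfold sadd, cst; lra.
- apply nI; auto with bdd; intro n; unfold sadd, cst; lra.
Qed.

(** For concave [I] the quotients do not increase with [t], so this supremum is the limit as [t]
    decreases to 0. *)
Definition directional_derivative (x d : seqR) : R :=
  sup (fun r => exists t, 0 < t /\ r = (I (sadd x (sscal t d)) - I x) / t).

Lemma directional_derivative_ge (x d : seqR) (t : R) : bounded x -> bounded d -> 0 < t ->
  (I (sadd x (sscal t d)) - I x) / t <= directional_derivative x d.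
Proof.
intros bx bd ht; destruct (bounded_range d bd) as [M [_ HM]].
apply (sup_ub _ M); [|exists t; auto].
intros r [s [hs ->]]; apply (Rmult_le_reg_l s); [exact hs|].
replace (s * ((I (sadd x (sscal s d)) - I x) / s)) with (I (sadd x (sscal s d)) - I x)
  by (field; lra).
enough (I (sadd x (sscal s d)) + - (s * M) <= I x) by lra.
apply nI; auto with bdd; intro n; unfold sadd, sscal; specialize (HM n); nra.
Qed.

Lemma directional_derivative_ge_difference (x y : seqR) : bounded x -> bounded y ->
  I y - I x <= directional_derivative x (sadd y (sscal (-1) x)).
Proof.
intros bx by_.
assert (h := directional_derivative_ge x (sadd y (sscal (-1) x)) 1 bx
  ltac:(auto with bdd) Rlt_0_1).
replace (sadd x (sscal 1 (sadd y (sscal (-1) x)))) with y in h by seq_ext.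
rewrite Rdiv_1_r in h; exact h.
Qed.

Lemma directional_derivative_coherent (x : seqR) :
  bounded x -> coherent (directional_derivative x).
Proof.
intro bx; repeat split.
- intros d e bd be; apply sup_plus_le.
  + exists ((I (sadd x (sscal 1 d)) - I x) / 1), 1; split; [lra | reflexivity].
  + exists ((I (sadd x (sscal 1 e)) - I x) / 1), 1; split; [lra | reflexivity].
  + intros a b [t [ht ->]] [s [hs ->]].
    (* [x + u (d + e)] with [1/u = 1/t + 1/s] is a mixture of [x + t d] and [x + s e]. *)
    pose (u := t * s / (t + s)).
    assert (hu : 0 < u) by (apply Rdiv_lt_0_compat; nra).
    eapply Rle_trans; [|apply (directional_derivative_ge x (sadd d e) u); auto with bdd].
    assert (hl : 0 <= s / (t + s) <= 1).
    { split; [apply Rdiv_le_0_compat; lra|].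
      apply (Rmult_le_reg_r (t + s)); [lra|].
      replace (s / (t + s) * (t + s)) with s by (field; lra); lra. }
    assert (h := proj2 nI (sadd x (sscal t d)) (sadd x (sscal s e)) (s / (t + s))
      ltac:(auto with bdd) ltac:(auto with bdd) hl).
    replace (mix (s / (t + s)) (sadd x (sscal t d)) (sadd x (sscal s e)))
      with (sadd x (sscal u (sadd d e))) in h by (unfold u; seq_ext; lra).
    set (A := I (sadd x (sscal t d))) in *; set (B := I (sadd x (sscal s e))) in *.
    apply (Rmult_le_reg_l u); [exact hu|].
    replace (u * ((I (sadd x (sscal u (sadd d e))) - I x) / u))
      with (I (sadd x (sscal u (sadd d e))) - I x) by (field; lra).
    replace (u * ((A - I x) / t + (B - I x) / s))
      with (s / (t + s) * A + (1 - s / (t + s)) * B - I x) by (unfold u; field; lra).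
    lra.
- intros a d [ha | <-] bd.
  + apply sup_scal_le; [exact ha | |].
    { exists ((I (sadd x (sscal 1 d)) - I x) / 1), 1; split; [lra | reflexivity]. }
    intros r [t [ht ->]].
    eapply Rle_trans; [|apply (directional_derivative_ge x (sscal a d) (t / a)); auto with bdd].
    * replace (sadd x (sscal (t / a) (sscal a d))) with (sadd x (sscal t d))
        by (seq_ext; lra).
      apply Req_le; field; lra.
    * apply Rdiv_lt_0_compat; auto.
  + rewrite Rmult_0_l.
    eapply Rle_trans; [|apply (directional_derivative_ge x (sscal 0 d) 1); auto with bdd; lra].
    replace (sadd x (sscal 1 (sscal 0 d))) with x by seq_ext; lra.
- intros t d bd H.
  eapply Rle_trans; [|apply (directional_derivative_ge x d 1); auto; lra].
  enough (I x + t <= I (sadd x (sscal 1 d))) by lra.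
  apply nI; auto with bdd; intro n; specialize (H n); unfold sadd, sscal, cst in *; lra.
Qed.

(** A supremum equal to 0 need not be attained, so [d] is raised by [eps]: some quotient is then
    nonnegative and delay aversion applies to it. Delaying the raised [d] adds at most [eps] to
    [delay d]. *)
Lemma directional_derivative_delay (x d : seqR) :
  bounded x -> delay_averse_at I x -> bounded d ->
  0 <= directional_derivative x d -> 0 <= directional_derivative x (delay d).
Proof.
intros bx av bd hd; assert (cg := directional_derivative_coherent x bx).
set (g := directional_derivative x) in *.
apply le_epsilon; intros eps heps.
assert (bde : bounded (sadd d (cst eps))) by auto with bdd.
assert (ge : g (sadd d (cst eps)) > 0).
{ assert (h := coherent_ge g cg (sadd d (cst eps)) d eps bde bd).
  enough (g d + eps <= g (sadd d (cst eps))) by lra.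
  apply h; intro n; unfold sadd, cst; lra. }
assert (hS : 0 <= g (delay (sadd d (cst eps)))).
{ destruct (classic (exists t, 0 < t /\ I x <= I (sadd x (sscal t (sadd d (cst eps))))))
    as [[t [ht le]] | none].
  - apply av in le; [|auto with bdd].
    eapply Rle_trans; [|apply (directional_derivative_ge x _ t); auto with bdd].
    apply Rdiv_le_0_compat; [|exact ht].
    replace (sscal t (delay (sadd d (cst eps)))) with (delay (sscal t (sadd d (cst eps))));
      [lra | seq_ext].
  - exfalso; enough (g (sadd d (cst eps)) <= 0) by lra.
    unfold g, directional_derivative; eapply sup_le.
    + exists 1; split; [lra | reflexivity].
    + intros r [t [ht ->]].
      enough (I (sadd x (sscal t (sadd d (cst eps)))) - I x < 0).
      { apply (Rmult_le_reg_l t); [exact ht|].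
        replace (t * (_ / t)) with (I (sadd x (sscal t (sadd d (cst eps)))) - I x)
          by (field; lra); lra. }
      apply Rnot_le_lt; intro h; apply none; exists t; split; [exact ht | lra]. }
assert (h := coherent_ge g cg (delay d) (delay (sadd d (cst eps))) (- eps)).
enough (g (delay (sadd d (cst eps))) + - eps <= g (delay d)) by lra.
apply h; auto with bdd; intros [|n]; unfold sadd, cst; simpl; lra.
Qed.

(** With [g] the directional derivative at [x] and [p >= g], one has
    [I y - I x <= g (y - x) <= p (y - x)]. *)
Lemma supergradient_in_D (x : seqR) : bounded x -> delay_averse_at I x ->
  exists p, in_D p /\ forall y, bounded y -> I y - p y <= I x - p x.
Proof.
intros bx av.
destruct (delay_eigenvector _ (directional_derivative_coherent x bx)
  (fun d => directional_derivative_delay x d bx av)) as [p [a [dp [ha [pS gp]]]]].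
exists p; split; [apply (eigenvector_in_D p a); auto|].
intros y by_.
assert (h1 := directional_derivative_ge_difference x y bx by_).
specialize (gp (sadd y (sscal (-1) x)) ltac:(auto with bdd)).
rewrite (Delta_lin p y x (sadd y (sscal (-1) x)) 1 (-1)) in gp; auto; [lra|].
intro n; unfold sadd, sscal; ring.
Qed.

Lemma penalty_ub (p : functional) (y : seqR) :
  bounded y -> Rbar_le (I y - p y) (penalty I p).
Proof. intro by_; apply Lub_Rbar_correct; exists y; auto. Qed.

Lemma penalty_supergradient (p : functional) (x : seqR) : bounded x ->
  (forall y, bounded y -> I y - p y <= I x - p x) -> penalty I p = I x - p x.
Proof.
intros bx H; apply is_lub_Rbar_unique; split.
- intros r [y [by_ ->]]; apply H, by_.
- intros b Hb; apply Hb; exists x; auto.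
Qed.

(** A supremum of the weak-star continuous maps sending [p] to [I y - p y]: one [y] exceeding [t]
    defines the neighbourhood, and the excess is its radius. *)
Lemma penalty_lsc : weakstar_lsc_on_D (penalty I).
Proof.
intros p _ t lt.
destruct (classic (exists y, bounded y /\ t < I y - p y)) as [[y [by_ hy]] | none].
- exists (y :: nil), (I y - p y - t); split; [lra|]; split; [auto|].
  intros q _ near; specialize (near y (or_introl eq_refl)).
  apply (Rbar_lt_le_trans _ (I y - q y)); [|apply penalty_ub, by_].
  simpl; apply Rabs_lt_between in near; lra.
- exfalso; apply (Rbar_lt_not_le _ _ lt).
  apply Lub_Rbar_correct; intros r [y [by_ ->]]; simpl.
  apply Rnot_lt_le; intro h; apply none; eauto.
Qed.

(** The inequality is built into the conjugate; a supergradient at [x] attains it. *)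
Lemma penalty_min_repr :
  (forall x, bounded x -> delay_averse_at I x) -> is_min_repr (penalty I) I.
Proof.
intros av x bx; split.
- destruct (supergradient_in_D x bx (av x bx)) as [p [Dp Hp]].
  exists p; split; [exact Dp|]; rewrite (penalty_supergradient p x bx Hp).
  simpl; f_equal; ring.
- intros p _; assert (h := penalty_ub p x bx).
  destruct (penalty I p); simpl in *; try exact Logic.I; [lra | tauto].
Qed.

(** Taking [y = 0] in the supremum shows nonnegativity, and a supergradient at 0 has penalty exactly
    0. *)
Lemma penalty_grounded :
  I (cst 0) = 0 -> delay_averse_at I (cst 0) -> grounded (penalty I).
Proof.
intros I0 av.
assert (p0 : forall p, in_D p -> p (cst 0) = 0).
{ intros p Dp; apply coherent_cst, Delta_coherent, in_D_eigenvector, Dp. }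
split.
- intros p Dp; assert (h := penalty_ub p (cst 0) (bounded_cst 0)).
  rewrite I0, (p0 p Dp), Rminus_0_r in h; exact h.
- intros eps heps.
  destruct (supergradient_in_D (cst 0) (bounded_cst 0) av) as [p [Dp Hp]].
  exists p; split; [exact Dp|].
  rewrite (penalty_supergradient p (cst 0) (bounded_cst 0) Hp), I0, (p0 p Dp).
  simpl; lra.
Qed.

End Niveloid.

(** * Minima over D of penalised expectations *)

Section MinRepresentation.
Context (c : functional -> Rbar) (I : functional) (min_cI : is_min_repr c I).

(** The minimum is real, so the minimiser has a finite penalty [r], and [p + r] is an affine
    majorant touching [I] at [x]. *)
Lemma min_repr_witness (x : seqR) : bounded x ->
  exists p r, in_D p /\ I x = p x + r /\ forall y, bounded y -> I y <= p y + r.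
Proof.
intro bx; destruct (proj1 (min_cI x bx)) as [p [Dp eq]].
destruct (c p) as [r| |] eqn:cp; try discriminate eq.
exists p, r; split; [exact Dp|]; split; [injection eq; auto|].
intros y by_; assert (h := proj2 (min_cI y by_) p Dp); rewrite cp in h; exact h.
Qed.

(** Each clause bounds [I] from below at one point; the affine majorant touching [I] there
    suffices. *)
Lemma min_repr_niveloid : concave_niveloid I.
Proof.
split.
- intros x y t bx by_ H; destruct (min_repr_witness x bx) as [p [r [Dp [eq le]]]].
  assert (cp := Delta_coherent p (proj1 (in_D_eigenvector p Dp))).
  assert (h := coherent_ge p cp x y t bx by_ H); specialize (le y by_); lra.
- intros x y l bx by_ hl.
  destruct (min_repr_witness (mix l x y) ltac:(auto with bdd)) as [p [r [Dp [eq le]]]].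
  rewrite (Delta_lin p x y (mix l x y) l (1 - l)) in eq;
    [|apply in_D_eigenvector, Dp | auto | auto | reflexivity].
  assert (hx := le x bx); assert (hy := le y by_); nra.
Qed.

(** For the majorant [p + r] touching at [x + S d], the value there is
    [(1 - a) (p x + r) + a (p (x + d) + r)], hence at least [(1 - a) I x + a I (x + d)]. *)
Lemma min_repr_delay_averse (x : seqR) : bounded x -> delay_averse_at I x.
Proof.
intros bx d bd hd.
destruct (min_repr_witness (sadd x (delay d)) ltac:(auto with bdd)) as [p [r [Dp [eq le]]]].
destruct (in_D_eigenvector p Dp) as [dp [a [ha pS]]].
assert (add : forall y, bounded y -> p (sadd x y) = p x + p y).
{ intros y by_; rewrite (Delta_lin p x y (sadd x y) 1 1); auto; [lra|].
  intro n; unfold sadd; ring. }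
rewrite add, pS in eq by auto with bdd.
assert (h1 := le x bx); assert (h2 := le (sadd x d) ltac:(auto with bdd)).
rewrite add in h2 by auto.
assert (h3 : (1 - a) * I x <= (1 - a) * (p x + r)) by (apply Rmult_le_compat_l; lra).
assert (h4 : a * I x <= a * (p x + p d + r)) by (apply Rmult_le_compat_l; lra).
lra.
Qed.

End MinRepresentation.

(** * Closed sets of mixing weights *)

Lemma closed_set_limit (D : R -> Prop) (a : R) : closed_set D ->
  (forall eps, 0 < eps -> exists b, D b /\ Rabs (b - a) < eps) -> D a.
Proof.
intros clD lim; apply NNPP; intro nD.
destruct (clD a nD) as [eps H].
destruct (lim eps (cond_pos eps)) as [b [Db hb]]; exact (H b hb Db).
Qed.

Lemma closed_set_intro (D : R -> Prop) :
  (forall a, (forall eps, 0 < eps -> exists b, D b /\ Rabs (b - a) < eps) -> D a) ->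
  closed_set D.
Proof.
intros H a nDa; apply NNPP; intro none; apply nDa, H; intros eps heps.
apply NNPP; intro no_b; apply none; exists (mkposreal eps heps).
intros b hb Db; apply no_b; exists b; auto.
Qed.

Lemma closed_superlevel_01 (f : R -> R) (K t : R) (Q : R -> Prop) :
  0 <= K -> (forall a b, f b <= f a + K * Rabs (b - a)) ->
  (forall a, Q a <-> t <= f a) -> closed_set (fun a => 0 <= a <= 1 /\ Q a).
Proof.
intros hK lip HQ; apply closed_set_intro; intros a lim.
assert (close : forall eps, 0 < eps ->
  (- eps <= a <= 1 + eps) /\ t <= f a + eps).
{ intros eps heps.
  (* This radius keeps both [|b - a|] and [K |b - a|] below [eps], including when [K = 0]. *)
  destruct (lim (eps / (K + 1))) as [b [[hb Qb] near]]; [apply Rdiv_lt_0_compat; lra|].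
  apply HQ in Qb; specialize (lip a b).
  assert (hKe : (K + 1) * (eps / (K + 1)) = eps) by (field; lra).
  assert (he : 0 < eps / (K + 1)) by (apply Rdiv_lt_0_compat; lra).
  assert (hp := Rabs_pos (b - a)).
  assert (near' := near); apply Rabs_lt_between in near'; nra. }
repeat split.
- apply le_epsilon; intros eps heps; specialize (close eps heps); lra.
- apply le_epsilon; intros eps heps; specialize (close eps heps); lra.
- apply HQ, le_epsilon; intros eps heps; specialize (close eps heps); lra.
Qed.

(** Connectedness of the unit interval: the supremum [s] of [B] lies in [B] by closedness, and in
    [A] as a limit of points above [s], or because [s = 1]. *)
Lemma closed_cover_01 (A B : R -> Prop) :
  closed_set (fun a => 0 <= a <= 1 /\ A a) -> closed_set (fun a => 0 <= a <= 1 /\ B a) ->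
  (forall a, 0 <= a <= 1 -> A a \/ B a) -> B 0 -> A 1 ->
  exists a, 0 <= a <= 1 /\ A a /\ B a.
Proof.
intros clA clB cover B0 A1.
set (D := fun a => 0 <= a <= 1 /\ B a) in *.
assert (D0 : D 0) by (split; [lra | exact B0]).
assert (D1 : forall a, D a -> a <= 1) by (intros a [h _]; lra).
destruct (sup_lub D 1 0 D0 D1) as [up least].
set (s := sup D) in *.
assert (hs : 0 <= s <= 1) by (split; [apply up, D0 | apply least, D1]).
assert (Ds : D s).
{ apply closed_set_limit; [exact clB|]; intros eps heps.
  apply NNPP; intro none; enough (s <= s - eps) by lra.
  apply least; intros b Db; apply Rnot_lt_le; intro hb; apply none.
  exists b; split; [exact Db|]; specialize (up b Db); rewrite Rabs_left1; lra. }
exists s; split; [exact hs|]; split; [|apply Ds].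
destruct (Req_dec s 1) as [-> | s1]; [exact A1|].
refine (proj2 (closed_set_limit _ s clA _)); intros eps heps.
pose (b := Rmin 1 (s + eps / 2)).
assert (hb : s < b <= 1 /\ b - s < eps).
{ unfold b, Rmin; destruct (Rle_dec 1 (s + eps / 2)); lra. }
exists b; split; [|rewrite Rabs_right; lra].
split; [lra|]; destruct (cover b ltac:(lra)) as [Ab | Bb]; [exact Ab|].
assert (h : b <= s) by (apply up; split; [lra | exact Bb]); lra.
Qed.

(** * Preferences *)

Section Represented.
Context (pref : seqR -> seqR -> Prop) (I : functional) (nI : concave_niveloid I).
Context (rep : forall x y, bounded x -> bounded y -> (pref x y <-> I y <= I x)).

Lemma represented_weak_order : WeakOrder pref.
Proof.
split.
- intros x y bx by_; rewrite !rep by auto; lra.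
- intros x y z bx by_ bz; rewrite !rep by auto; lra.
Qed.

Lemma represented_monotonicity : Monotonicity pref.
Proof.
split.
- intros x y bx by_ H; apply rep; auto.
  rewrite <- (Rplus_0_r (I y)); apply nI; auto.
  intro n; specialize (H n); lra.
- assert (h := proj1 nI (cst 1) (cst 0) 1 (bounded_cst 1) (bounded_cst 0)).
  assert (h' : I (cst 0) + 1 <= I (cst 1)) by (apply h; intro n; unfold cst; lra).
  split; rewrite rep by auto with bdd; lra.
Qed.

(** Niveloids are 1-Lipschitz in the sup norm, so [I] is Lipschitz along the segment with constant
    [M + N]. *)
Lemma represented_continuity : Continuity pref.
Proof.
intros x y z bx by_ bz _ _.
destruct (bounded_range x bx) as [M [hM HM]], (bounded_range z bz) as [N [hN HN]].
assert (lip : forall a b, I (mix b x z) <= I (mix a x z) + (M + N) * Rabs (b - a)).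
{ intros a b.
  enough (I (mix b x z) + - ((M + N) * Rabs (b - a)) <= I (mix a x z)) by lra.
  apply nI; auto with bdd; intro n; unfold mix; specialize (HM n); specialize (HN n).
  unfold Rabs; destruct (Rcase_abs (b - a)); nra. }
split.
- apply (closed_superlevel_01 (fun a => I (mix a x z)) (M + N) (I y)); [lra | exact lip|].
  intro a; apply rep; auto with bdd.
- apply (closed_superlevel_01 (fun a => - I (mix a x z)) (M + N) (- I y)); [lra | |].
  + intros a b; specialize (lip b a); rewrite Rabs_minus_sym in lip; lra.
  + intro a; rewrite rep by auto with bdd; lra.
Qed.

Lemma represented_icrp : ICRP pref.
Proof.
intros x y t bx by_; rewrite !rep by auto with bdd.
rewrite !niveloid_translation by auto; lra.
Qed.

Lemma represented_convexity : Convexity pref.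
Proof.
intros x y t l bx by_ hl; rewrite !rep by auto with bdd; intros hx hy.
assert (h := proj2 nI x y l bx by_ hl); nra.
Qed.

End Represented.

(** * The certainty equivalent as a concave niveloid *)

Section Preference.
Context (pref : seqR -> seqR -> Prop).
Context (order : WeakOrder pref) (mono : Monotonicity pref) (cont : Continuity pref).
Context (icrp : ICRP pref) (conv : Convexity pref).

Definition certainty_equivalent (x : seqR) : R := sup (fun t => pref x (cst t)).

Let total := proj1 order.
Let trans := proj2 order.

(** If [s < t] and [s] were weakly preferred to [t], ICRP would make 0 weakly preferred to every
    [n (t - s)], hence to 1, against the strict preference of 1 over 0. *)
Lemma pref_cst (s t : R) : pref (cst s) (cst t) <-> t <= s.
Proof.
split; [|intro h; apply mono; auto with bdd; intro n; exact h].
intro h; apply Rnot_lt_le; intro lt.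
assert (h0 : pref (cst 0) (cst (t - s))).
{ apply (icrp _ _ (- s)) in h; auto with bdd.
  replace (sadd (cst s) (cst (- s))) with (cst 0) in h by seq_ext.
  replace (sadd (cst t) (cst (- s))) with (cst (t - s)) in h by seq_ext; exact h. }
assert (hn : forall n, pref (cst 0) (cst (INR n * (t - s)))).
{ induction n as [|n IH].
  - simpl; rewrite Rmult_0_l; apply mono; auto with bdd; intro n; apply Rle_refl.
  - apply (icrp _ _ (t - s)) in IH; auto with bdd.
    replace (sadd (cst 0) (cst (t - s))) with (cst (t - s)) in IH by seq_ext.
    replace (sadd (cst (INR n * (t - s))) (cst (t - s))) with (cst (INR (S n) * (t - s)))
      in IH by (rewrite S_INR; seq_ext).
    apply (trans _ (cst (t - s))); auto with bdd. }
destruct (INR_archimed (t - s) 1) as [n gt1]; [lra|].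
apply (proj2 (proj2 mono)), (trans _ (cst (INR n * (t - s)))); auto with bdd.
apply mono; auto with bdd; intro k; unfold cst; lra.
Qed.

(** Continuity along the constants from [- M] to [M]: the two closed sets of weights cover the unit
    interval, so they meet. *)
Lemma certainty_equivalent_exists (x : seqR) :
  bounded x -> exists t, indiff pref x (cst t).
Proof.
intro bx; destruct (bounded_range x bx) as [M [hM HM]].
assert (h1 : pref (cst M) x) by (apply mono; auto with bdd; intro n; apply HM).
assert (h2 : pref x (cst (- M))) by (apply mono; auto with bdd; intro n; apply HM).
destruct (cont (cst M) x (cst (- M))) as [clA clB]; auto with bdd.
destruct (closed_cover_01 _ _ clA clB) as [a [_ [Aa Ba]]].
- intros a _; apply total; auto with bdd.
- replace (mix 0 (cst M) (cst (- M))) with (cst (- M)) by seq_ext; exact h2.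
- replace (mix 1 (cst M) (cst (- M))) with (cst M) by seq_ext; exact h1.
- exists (a * M + (1 - a) * - M); split; [exact Ba | exact Aa].
Qed.

Lemma certainty_equivalent_indiff (x : seqR) :
  bounded x -> indiff pref x (cst (certainty_equivalent x)).
Proof.
intro bx; destruct (certainty_equivalent_exists x bx) as [t [h1 h2]].
replace (certainty_equivalent x) with t; [split; auto|].
assert (le : forall r, pref x (cst r) -> r <= t).
{ intros r hr; apply pref_cst, (trans _ x); auto with bdd. }
apply Rle_antisym.
- apply (sup_ub (fun r => pref x (cst r)) t t le h1).
- apply (sup_le (fun r => pref x (cst r)) t t h1 le).
Qed.

Lemma certainty_equivalent_represents (x y : seqR) : bounded x -> bounded y ->
  (pref x y <-> certainty_equivalent y <= certainty_equivalent x).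
Proof.
intros bx by_.
destruct (certainty_equivalent_indiff x bx) as [x1 x2].
destruct (certainty_equivalent_indiff y by_) as [y1 y2].
rewrite <- pref_cst; split; intro h.
- apply (trans _ x); auto with bdd; apply (trans _ y); auto with bdd.
- apply (trans _ (cst (certainty_equivalent x))); auto with bdd.
  apply (trans _ (cst (certainty_equivalent y))); auto with bdd.
Qed.

Lemma certainty_equivalent_unique (x : seqR) (t : R) :
  bounded x -> indiff pref x (cst t) -> certainty_equivalent x = t.
Proof.
intros bx [h1 h2]; destruct (certainty_equivalent_indiff x bx) as [x1 x2].
apply Rle_antisym; apply pref_cst; apply (trans _ x); auto with bdd.
Qed.

Lemma certainty_equivalent_translation (x : seqR) (t : R) : bounded x ->
  certainty_equivalent (sadd x (cst t)) = certainty_equivalent x + t.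
Proof.
intro bx; destruct (certainty_equivalent_indiff x bx) as [x1 x2].
apply certainty_equivalent_unique; auto with bdd.
replace (cst (certainty_equivalent x + t)) with (sadd (cst (certainty_equivalent x)) (cst t))
  by seq_ext.
split; apply icrp; auto with bdd.
Qed.

Lemma certainty_equivalent_niveloid : concave_niveloid certainty_equivalent.
Proof.
split.
- intros x y t bx by_ H; rewrite <- certainty_equivalent_translation by auto.
  apply certainty_equivalent_represents; auto with bdd.
  apply mono; auto with bdd.
- intros x y l bx by_ hl.
  (* By translation invariance one may assume that [x] and [y] are indifferent to 0. *)
  set (s := certainty_equivalent x); set (t := certainty_equivalent y).
  assert (nonneg : forall z, bounded z -> pref (sadd z (cst (- certainty_equivalent z))) (cst 0)).
  { intros z bz; apply (trans _ (cst (certainty_equivalent (sadd z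
      (cst (- certainty_equivalent z)))))); auto with bdd.
    - apply certainty_equivalent_indiff; auto with bdd.
    - rewrite certainty_equivalent_translation by auto; apply pref_cst; lra. }
  assert (h := conv _ _ 0 l (bounded_sadd _ _ bx (bounded_cst (- s)))
    (bounded_sadd _ _ by_ (bounded_cst (- t))) hl (nonneg x bx) (nonneg y by_)).
  replace (mix l (sadd x (cst (- s))) (sadd y (cst (- t))))
    with (sadd (mix l x y) (cst (- (l * s + (1 - l) * t)))) in h by seq_ext.
  apply certainty_equivalent_represents in h; auto with bdd.
  rewrite certainty_equivalent_translation in h by auto with bdd.
  rewrite (certainty_equivalent_unique (cst 0) 0) in h; auto with bdd; [lra|].
  split; apply pref_cst; lra.
Qed.

End Preference.

(** * Equivalence of the axioms and the variational representation over D *)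

Theorem theorem5 (pref : seqR -> seqR -> Prop) :
  (WeakOrder pref /\ Monotonicity pref /\ Continuity pref /\ ICRP pref /\
   Convexity pref /\ IDIS pref)
  <->
  (exists c : functional -> Rbar,
     grounded c /\ weakstar_lsc_on_D c /\
     exists I : seqR -> R, is_min_repr c I /\ constant_equivalent pref I).
Proof.
split.
- intros [order [mono [cont [icrp [conv idis]]]]].
  set (I := certainty_equivalent pref).
  assert (nI : concave_niveloid I) by (apply certainty_equivalent_niveloid; auto).
  assert (rep := certainty_equivalent_represents pref order mono cont icrp); fold I in rep.
  assert (av : forall x, bounded x -> delay_averse_at I x).
  { intros x bx d bd; rewrite <- !rep by auto with bdd; apply idis; auto. }
  assert (I0 : I (cst 0) = 0).
  { apply certainty_equivalent_unique; auto with bdd.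
    split; apply mono; auto with bdd; intro n; apply Rle_refl. }
  exists (penalty I); split; [apply penalty_grounded; auto with bdd|].
  split; [apply penalty_lsc|].
  exists I; split; [apply penalty_min_repr; auto|].
  split; [|exact rep].
  apply certainty_equivalent_indiff; auto.
- intros [c [_ [_ [I [min_cI [_ rep]]]]]].
  assert (nI := min_repr_niveloid c I min_cI).
  split; [exact (represented_weak_order pref I rep)|].
  split; [exact (represented_monotonicity pref I nI rep)|].
  split; [exact (represented_continuity pref I nI rep)|].
  split; [exact (represented_icrp pref I nI rep)|].
  split; [exact (represented_convexity pref I nI rep)|].
  intros x d bx bd; rewrite !rep by auto with bdd.
  apply (min_repr_delay_averse c I min_cI); auto.
Qed.
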